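(* The symmetric monoidal category $\mathtt{CxBiFn}$ has the structure of a hypergraph category in two different ways, called the additive and the co-additive structure. That is, every object $\mathbb R^n$ carries two different structures of a special commutative Frobenius algebra: 1. The additive structure is given by \begin{align*} \mathrm{unit}&: I\to\mathbb R^n, & \mathrm{unit}(\mathbf 0,x)&=0,\\ \mathrm{discard}&:\mathbb R^n\to I, & \mathrm{discard}(x,\mathbf 0)&=0,\\ \mathrm{copy}&:\mathbb R^n\to\mathbb R^n\otimes\mathbb R^n, & \mathrm{copy}(x,y,z)&=\{|x=y=z|\},\\ \mathrm{comp}&:\mathbb R^n\otimes\mathbb R^n\to\mathbb R^n, & \mathrm{comp}(x,y,z)&=\{|x=y=z|\}. \end{align*} 2. The co-additive structure is given by \begin{align*} \mathrm{zero}&: I\to\mathbb R^n, & \mathrm{zero}(\mathbf 0,x)&=\{|x=0|\},\\ \mathrm{cozero}&:\mathbb R^n\to I, & \mathrm{cozero}(x,\mathbf 0)&=\{|x=0|\},\\ \mathrm{add}&:\mathbb R^n\otimes\mathbb R^n\to\mathbb R^n, & \mathrm{add}(x,y,z)&=\{|x+y=z|\},\\ \mathrm{coadd}&:\mathbb R^n\to\mathbb R^n\otimes\mathbb R^n, & \mathrm{coadd}(z,x,y)&=\{|x+y=z|\}. \end{align*} The analogous structures on $\mathtt{CvBiFn}$ use concave indicator functions $-\{|\cdot|\}$ instead.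
   Context: Notation: $\overline{\mathbb R}=[-\infty,+\infty]$; $\{|P|\}$ is the convex indicator, equal to $0$ if $P$ holds and $+\infty$ otherwise. A function into $\overline{\mathbb R}$ is convex if its epigraph is convex, concave if its negative is convex. A convex (concave) bifunction from $\mathbb R^m$ to $\mathbb R^n$ is a jointly convex (concave) function $\mathbb R^m\times\mathbb R^n\to\overline{\mathbb R}$. $\mathtt{CxBiFn}$: objects $\mathbb R^n$ ($n\ge0$), morphisms $\mathbb R^m\to\mathbb R^n$ the convex bifunctions, identities $\{|x=y|\}$, composition $(F\circ G)(x,z)=\inf_y\{G(x,y)+F(y,z)\}$. $\mathtt{CvBiFn}$: concave bifunctions, identities $-\{|x=y|\}$, composition $(F\circ G)(x,z)=\sup_y\{G(x,y)+F(y,z)\}$. Addition uses $(+\infty)+(-\infty)=+\infty$ in $\mathtt{CxBiFn}$ and $=-\infty$ in $\mathtt{CvBiFn}$. Both are symmetric strict monoidal with $\mathbb R^m\otimes\mathbb R^n=\mathbb R^{m+n}$, unit $I=\mathbb R^0=\{\mathbf 0\}$ and $(F\otimes G)((x_1,x_2),(y_1,y_2))=F(x_1,y_1)+G(x_2,y_2)$. A hypergraph category is a symmetric monoidal category in which every object carries the structure of a special commutative Frobenius algebra (commutative monoid and cocommutative comonoid, satisfying the Frobenius law, with comultiplication followed by multiplication equal to the identity), compatible with the tensor product. *)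

(* Defs.v *)
From HB Require Import structures.
From mathcomp Require Import all_boot all_order all_algebra.
From mathcomp Require Import mathcomp_extra boolp classical_sets reals constructive_ereal ereal.
From mathcomp Require Import interval_inference topology convex.
Set Implicit Arguments.
Unset Strict Implicit.
Unset Printing Implicit Defensive.
Import Order.TTheory GRing.Theory Num.Theory DualAddTheory.

Record smc_data := SmcData {
  obj : Type;
  hom : obj -> obj -> Type;
  idm : forall a, hom a a;
  compm : forall a b c, hom b c -> hom a b -> hom a c;
  tens : obj -> obj -> obj;
  munit : obj;
  tensm : forall a b c d, hom a b -> hom c d -> hom (tens a c) (tens b d);
  assoc : forall a b c, hom (tens (tens a b) c) (tens a (tens b c));
  unassoc : forall a b c, hom (tens a (tens b c)) (tens (tens a b) c);
  lunit : forall a, hom (tens munit a) a;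
  unlunit : forall a, hom a (tens munit a);
  runit : forall a, hom (tens a munit) a;
  unrunit : forall a, hom a (tens a munit);
  braid : forall a b, hom (tens a b) (tens b a) }.

Arguments idm {s} a.
Arguments compm {s a b c} g f.
Arguments tensm {s a b c d} f g.
Arguments assoc {s} a b c.
Arguments unassoc {s} a b c.
Arguments lunit {s} a.
Arguments unlunit {s} a.
Arguments runit {s} a.
Arguments unrunit {s} a.
Arguments braid {s} a b.

Declare Scope smc_scope.
Delimit Scope smc_scope with smc.
Local Open Scope smc_scope.
Notation "g ∘ f" := (compm g f)
  (at level 40, left associativity) : smc_scope.
Notation "f ⊗ g" := (tensm f g)
  (at level 35, right associativity) : smc_scope.

Record symmetric_monoidal (C : smc_data) : Prop := SymmetricMonoidal {
  comp1m : forall (a b : obj C) (f : hom a b), idm b ∘ f = f;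
  compm1 : forall (a b : obj C) (f : hom a b), f ∘ idm a = f;
  compmA : forall (a b c d : obj C) (h : hom c d) (g : hom b c) (f : hom a b),
    h ∘ (g ∘ f) = (h ∘ g) ∘ f;
  tensm1 : forall a b : obj C, idm a ⊗ idm b = idm (tens a b);
  tensmM : forall (a b c a' b' c' : obj C)
      (g : hom b c) (f : hom a b) (g' : hom b' c') (f' : hom a' b'),
    (g ∘ f) ⊗ (g' ∘ f') = (g ⊗ g') ∘ (f ⊗ f');
  assocK : forall a b c : obj C, unassoc a b c ∘ assoc a b c = idm _;
  unassocK : forall a b c : obj C, assoc a b c ∘ unassoc a b c = idm _;
  lunitK : forall a : obj C, unlunit a ∘ lunit a = idm _;
  unlunitK : forall a : obj C, lunit a ∘ unlunit a = idm _;
  runitK : forall a : obj C, unrunit a ∘ runit a = idm _;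
  unrunitK : forall a : obj C, runit a ∘ unrunit a = idm _;
  assoc_natural : forall (a b c a' b' c' : obj C)
      (f : hom a a') (g : hom b b') (h : hom c c'),
    assoc a' b' c' ∘ ((f ⊗ g) ⊗ h) = (f ⊗ (g ⊗ h)) ∘ assoc a b c;
  lunit_natural : forall (a b : obj C) (f : hom a b),
    lunit b ∘ (idm (munit C) ⊗ f) = f ∘ lunit a;
  runit_natural : forall (a b : obj C) (f : hom a b),
    runit b ∘ (f ⊗ idm (munit C)) = f ∘ runit a;
  braid_natural : forall (a b a' b' : obj C) (f : hom a a') (g : hom b b'),
    braid a' b' ∘ (f ⊗ g) = (g ⊗ f) ∘ braid a b;
  pentagon : forall a b c d : obj C,
    assoc a b (tens c d) ∘ assoc (tens a b) c d =
    (idm a ⊗ assoc b c d) ∘ assoc a (tens b c) d ∘ (assoc a b c ⊗ idm d);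
  triangle : forall a b : obj C,
    (idm a ⊗ lunit b) ∘ assoc a (munit C) b = runit a ⊗ idm b;
  hexagon : forall a b c : obj C,
    assoc b c a ∘ braid a (tens b c) ∘ assoc a b c =
    (idm b ⊗ braid a c) ∘ assoc b a c ∘ (braid a b ⊗ idm c);
  braidK : forall a b : obj C, braid b a ∘ braid a b = idm _ }.

Record frobenius_data (C : smc_data) (a : obj C) := FrobeniusData {
  fmul : hom (tens a a) a;
  funit : hom (munit C) a;
  fcomul : hom a (tens a a);
  fcounit : hom a (munit C) }.

Record special_commutative_frobenius (C : smc_data) (a : obj C)
    (S : frobenius_data a) : Prop := SpecialCommutativeFrobenius {
  fmulA : fmul S ∘ (fmul S ⊗ idm a) = fmul S ∘ (idm a ⊗ fmul S) ∘ assoc a a a;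
  fmul1l : fmul S ∘ (funit S ⊗ idm a) = lunit a;
  fmul1r : fmul S ∘ (idm a ⊗ funit S) = runit a;
  fmulC : fmul S ∘ braid a a = fmul S;
  fcomulA :
    assoc a a a ∘ (fcomul S ⊗ idm a) ∘ fcomul S = (idm a ⊗ fcomul S) ∘ fcomul S;
  fcomul1l : (fcounit S ⊗ idm a) ∘ fcomul S = unlunit a;
  fcomul1r : (idm a ⊗ fcounit S) ∘ fcomul S = unrunit a;
  fcomulC : braid a a ∘ fcomul S = fcomul S;
  frobeniusl : (idm a ⊗ fmul S) ∘ assoc a a a ∘ (fcomul S ⊗ idm a) =
    fcomul S ∘ fmul S;
  frobeniusr : (fmul S ⊗ idm a) ∘ unassoc a a a ∘ (idm a ⊗ fcomul S) =
    fcomul S ∘ fmul S;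
  fspecial : fmul S ∘ fcomul S = idm a }.

(* The canonical map (a b) (c d) -> (a c) (b d). *)
Definition middle_swap (C : smc_data) (a b c d : obj C) :
    hom (tens (tens a b) (tens c d)) (tens (tens a c) (tens b d)) :=
  unassoc a c (tens b d) ∘
  (idm a ⊗ (assoc c b d ∘ (braid b c ⊗ idm d) ∘ unassoc b c d)) ∘
  assoc a b (tens c d).

Record hypergraph_category (C : smc_data)
    (S : forall a : obj C, frobenius_data a) : Prop := HypergraphCategory {
  hypergraph_smc : symmetric_monoidal C;
  hypergraph_frobenius : forall a : obj C, special_commutative_frobenius (S a);
  fmul_tens : forall a b : obj C,
    fmul (S (tens a b)) = (fmul (S a) ⊗ fmul (S b)) ∘ middle_swap a b a b;
  funit_tens : forall a b : obj C,
    funit (S (tens a b)) = (funit (S a) ⊗ funit (S b)) ∘ unlunit (munit C);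
  fcomul_tens : forall a b : obj C,
    fcomul (S (tens a b)) = middle_swap a a b b ∘ (fcomul (S a) ⊗ fcomul (S b));
  fcounit_tens : forall a b : obj C,
    fcounit (S (tens a b)) = lunit (munit C) ∘ (fcounit (S a) ⊗ fcounit (S b));
  fmul_munit : fmul (S (munit C)) = lunit (munit C);
  funit_munit : funit (S (munit C)) = idm (munit C);
  fcomul_munit : fcomul (S (munit C)) = unlunit (munit C);
  fcounit_munit : fcounit (S (munit C)) = idm (munit C) }.

Arguments hypergraph_category C S : clear implicits.

Local Open Scope classical_set_scope.
Local Open Scope ring_scope.

Definition epigraph (R : realType) (E : lmodType R) (f : E -> \bar R) :
  set (E * R^o)%type := [set p | (f p.1 <= (p.2 : R)%:E)%E].

Definition cvx (R : realType) (E : lmodType R) (f : E -> \bar R) : Prop :=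
  convex_set (epigraph f).

Definition ccv (R : realType) (E : lmodType R) (f : E -> \bar R) : Prop :=
  cvx (fun x => - f x)%E.

Notation bifn R m n := ('rV[R]_m -> 'rV[R]_n -> \bar R).

Definition uncurry_bifn (R : realType) (m n : nat) (F : bifn R m n)
  (p : 'rV[R]_m * 'rV[R]_n) : \bar R := F p.1 p.2.

Record cxbifn (R : realType) (m n : nat) := CxBifn {
  cx_fun :> bifn R m n;
  cx_convex : cvx (uncurry_bifn cx_fun) }.

Record cvbifn (R : realType) (m n : nat) := CvBifn {
  cv_fun :> bifn R m n;
  cv_concave : ccv (uncurry_bifn cv_fun) }.

Arguments cx_convex {R m n} c.
Arguments cv_concave {R m n} c.

(* On \bar^d R the library's addition satisfies +oo + -oo = +oo; on \bar R it
   satisfies +oo + -oo = -oo. *)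
Definition cx_comp_fun (R : realType) (m n p : nat)
    (F : bifn R n p) (G : bifn R m n) : bifn R m p :=
  fun x z => ereal_inf (range (fun y : 'rV[R]_n => (G x y + F y z)%dE)).

Definition cv_comp_fun (R : realType) (m n p : nat)
    (F : bifn R n p) (G : bifn R m n) : bifn R m p :=
  fun x z => ereal_sup (range (fun y : 'rV[R]_n => (G x y + F y z)%E)).

Definition cx_tens_fun (R : realType) (m n p q : nat)
    (F : bifn R m n) (G : bifn R p q) : bifn R (m + p) (n + q) :=
  fun x y => (F (lsubmx x) (lsubmx y) + G (rsubmx x) (rsubmx y))%dE.

Definition cv_tens_fun (R : realType) (m n p q : nat)
    (F : bifn R m n) (G : bifn R p q) : bifn R (m + p) (n + q) :=
  fun x y => (F (lsubmx x) (lsubmx y) + G (rsubmx x) (rsubmx y))%E.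

Section ConvexityClosure.
Variable R : realType.

Lemma dadde_leP (x y : \bar R) (s : R) : (x + y <= s%:E)%dE <->
  exists a b : R, [/\ (x <= a%:E)%E, (y <= b%:E)%E & a + b <= s].
Proof.
split=> [|[a [b [xa yb abs]]]]; last first.
  by apply: (le_trans (lee_dD xa yb)); rewrite lee_fin.
case: x => [x||]; case: y => [y||] //.
- by rewrite lee_fin => xys; exists x, y; rewrite !lee_fin !lexx.
- move=> _; exists x, (s - x); rewrite lexx leNye; split=> //.
  by rewrite addrC subrK.
- move=> _; exists (s - y), y; rewrite lexx leNye; split=> //.
  by rewrite subrK.
- by move=> _; exists s, 0; rewrite !leNye addr0 lexx.
Qed.

Lemma cvxP (E : lmodType R) (f : E -> \bar R) : cvx f <->
  forall (t : {i01 R}) (x y : E) (a b : R), (f x <= a%:E)%E -> (f y <= b%:E)%E ->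
    (f (t%:num *: x + (1 - t%:num) *: y)%R <= (t%:num * a + (1 - t%:num) * b)%:E)%E.
Proof.
split=> [cf t x y a b xa yb|cf [x a] [y b] t]; last first.
  by rewrite !inE /epigraph /=; exact: cf.
by have := cf (x, a) (y, b) t; rewrite !inE /epigraph /=; exact.
Qed.

Lemma cx_comp_convex m n p (F : cxbifn R n p) (G : cxbifn R m n) :
  cvx (uncurry_bifn (cx_comp_fun F G)).
Proof.
have /cvxP cF := cx_convex F; have /cvxP cG := cx_convex G.
have H x z (r e : R) : 0 < e -> (cx_comp_fun F G x z <= r%:E)%E ->
    exists y (a b : R),
      [/\ (G x y <= a%:E)%E, (F y z <= b%:E)%E & a + b <= r + e].
  move=> e0 xr; have : (cx_comp_fun F G x z < (r + e)%:E)%E.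
    by apply: (le_lt_trans xr); rewrite lte_fin ltrDl.
  case/ereal_inf_lt => _ [y _ <-] /ltW /dadde_leP [a [b [? ? ?]]].
  by exists y, a, b.
apply/cvxP => t [x z] [x' z'] r r' /= xr xr'.
apply/lee_addgt0Pr => e e0.
have [y [a [b [Ga Fb ab]]]] := H _ _ _ _ e0 xr.
have [y' [a' [b' [Ga' Fb' ab']]]] := H _ _ _ _ e0 xr'.
apply: ge_ereal_inf => /=.
exists (G (t%:num *: x + (1 - t%:num) *: x')%R (t%:num *: y + (1 - t%:num) *: y')%R +
        F (t%:num *: y + (1 - t%:num) *: y')%R (t%:num *: z + (1 - t%:num) *: z')%R)%dE.
  by exists (t%:num *: y + (1 - t%:num) *: y').
apply/dadde_leP; exists (t%:num * a + (1 - t%:num) * a').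
exists (t%:num * b + (1 - t%:num) * b'); split.
- exact: (cG t (x, y) (x', y')).
- exact: (cF t (y, z) (y', z')).
have t0 : 0 <= t%:num by [].
have t1 : 0 <= (1 - t%:num) by rewrite subr_ge0.
have -> : t%:num * r + (1 - t%:num) * r' + e =
    t%:num * (r + e) + (1 - t%:num) * (r' + e).
  by rewrite !mulrDr addrACA -mulrDl subrKC mul1r.
by rewrite addrACA -!mulrDr lerD // ler_wpM2l.
Qed.

Lemma cx_tens_convex m n p q (F : cxbifn R m n) (G : cxbifn R p q) :
  cvx (uncurry_bifn (cx_tens_fun F G)).
Proof.
have /cvxP cF := cx_convex F; have /cvxP cG := cx_convex G.
apply/cvxP => t [x y] [x' y'] r r' /dadde_leP [a [b [Fa Gb ab]]].
move=> /dadde_leP [a' [b' [Fa' Gb' ab']]]; apply/dadde_leP => /=.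
exists (t%:num * a + (1 - t%:num) * a'), (t%:num * b + (1 - t%:num) * b'); split.
- have := cF t (lsubmx x, lsubmx y) (lsubmx x', lsubmx y') a a' Fa Fa'.
  by rewrite /uncurry_bifn /= -!linearZ -!linearD.
- have := cG t (rsubmx x, rsubmx y) (rsubmx x', rsubmx y') b b' Gb Gb'.
  by rewrite /uncurry_bifn /= -!linearZ -!linearD.
have t0 : 0 <= t%:num by [].
have t1 : 0 <= (1 - t%:num) by rewrite subr_ge0.
by rewrite addrACA -!mulrDr lerD // ler_wpM2l.
Qed.

Definition cv_opp m n (F : cvbifn R m n) : cxbifn R m n :=
  CxBifn (cx_fun := fun x y => (- F x y)%E) (cv_concave F).

Lemma cv_comp_concave m n p (F : cvbifn R n p) (G : cvbifn R m n) :
  ccv (uncurry_bifn (cv_comp_fun F G)).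
Proof.
have := @cx_comp_convex _ _ _ (cv_opp F) (cv_opp G).
congr cvx; apply/funext => -[x z] /=.
rewrite /uncurry_bifn /cx_comp_fun /cv_comp_fun /= -ereal_infN; congr ereal_inf.
rewrite image_comp; congr image; apply/funext => y /=.
by rewrite dual_addeE !oppeK.
Qed.

Lemma cv_tens_concave m n p q (F : cvbifn R m n) (G : cvbifn R p q) :
  ccv (uncurry_bifn (cv_tens_fun F G)).
Proof.
have := @cx_tens_convex _ _ _ _ (cv_opp F) (cv_opp G).
congr cvx; apply/funext => -[x z] /=.
by rewrite /uncurry_bifn /cx_tens_fun /cv_tens_fun /= dual_addeE !oppeK.
Qed.

End ConvexityClosure.

Arguments cx_comp_convex {R m n p} F G.
Arguments cv_comp_concave {R m n p} F G.
Arguments cx_tens_convex {R m n p q} F G.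
Arguments cv_tens_concave {R m n p q} F G.

Definition cx_comp (R : realType) (m n p : nat)
    (F : cxbifn R n p) (G : cxbifn R m n) : cxbifn R m p :=
  CxBifn (cx_comp_convex F G).

Definition cv_comp (R : realType) (m n p : nat)
    (F : cvbifn R n p) (G : cvbifn R m n) : cvbifn R m p :=
  CvBifn (cv_comp_concave F G).

Definition cx_tens (R : realType) (m n p q : nat)
    (F : cxbifn R m n) (G : cxbifn R p q) : cxbifn R (m + p) (n + q) :=
  CxBifn (cx_tens_convex F G).

Definition cv_tens (R : realType) (m n p q : nat)
    (F : cvbifn R m n) (G : cvbifn R p q) : cvbifn R (m + p) (n + q) :=
  CvBifn (cv_tens_concave F G).

Definition indic (R : realType) (b : bool) : \bar R := if b then 0%E else +oo%E.

Record linrel (R : realType) (m n : nat) := LinRel {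
  rel_fun :> 'rV[R]_m -> 'rV[R]_n -> bool;
  rel_lin : forall (a b : R) x x' y y', rel_fun x y -> rel_fun x' y' ->
    rel_fun (a *: x + b *: x') (a *: y + b *: y') }.

Section Indicators.
Variables (R : realType) (m n : nat).

Lemma cx_indic_convex (P : linrel R m n) :
  cvx (uncurry_bifn (fun x y => indic R (P x y))).
Proof.
apply/cvxP => t [x y] [x' y'] a b; rewrite /uncurry_bifn /indic /=.
case: ifP => // Pxy; case: ifP => // Pxy'; rewrite rel_lin // !lee_fin => a0 b0.
have t1 : 0 <= (1 - t%:num) by rewrite subr_ge0.
by rewrite addr_ge0 // mulr_ge0.
Qed.

Lemma cv_indic_concave (P : linrel R m n) :
  ccv (uncurry_bifn (fun x y => - indic R (P x y))%E).
Proof.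
have := @cx_indic_convex P; congr cvx; apply/funext => -[x y].
by rewrite /uncurry_bifn oppeK.
Qed.

Definition cx_indic (P : linrel R m n) : cxbifn R m n :=
  CxBifn (@cx_indic_convex P).

Definition cv_indic (P : linrel R m n) : cvbifn R m n :=
  CvBifn (@cv_indic_concave P).

Lemma cx_zero_convex : cvx (@uncurry_bifn R m n (fun _ _ => 0%E)).
Proof.
apply/cvxP => t [x y] [x' y'] a b; rewrite /uncurry_bifn !lee_fin => a0 b0.
have t1 : 0 <= (1 - t%:num) by rewrite subr_ge0.
by rewrite addr_ge0 // mulr_ge0.
Qed.

Lemma cv_zero_concave : ccv (@uncurry_bifn R m n (fun _ _ => 0%E)).
Proof.
have := @cx_zero_convex; congr cvx; apply/funext => -[x y].
by rewrite /uncurry_bifn oppe0.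
Qed.

Definition cx_zero : cxbifn R m n := CxBifn (@cx_zero_convex).

Definition cv_zero : cvbifn R m n := CvBifn (@cv_zero_concave).

End Indicators.

Section Relations.
Variable R : realType.

(* A pair (x, y) in R^m x R^n is encoded as w : 'rV_(m + n), with
   x = lsubmx w and y = rsubmx w. *)

Fact eq_rel_lin n (a b : R) (x x' y y' : 'rV[R]_n) :
  x == y -> x' == y' -> a *: x + b *: x' == a *: y + b *: y'.
Proof. by move=> /eqP -> /eqP ->. Qed.

Definition eq_rel n : linrel R n n :=
  LinRel (rel_fun := fun x y => x == y) (@eq_rel_lin n).

Fact swap_rel_lin m n (a b : R) (v v' : 'rV[R]_(m + n)) (w w' : 'rV[R]_(n + m)) :
  (lsubmx v == rsubmx w) && (rsubmx v == lsubmx w) ->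
  (lsubmx v' == rsubmx w') && (rsubmx v' == lsubmx w') ->
  (lsubmx (a *: v + b *: v') == rsubmx (a *: w + b *: w')) &&
  (rsubmx (a *: v + b *: v') == lsubmx (a *: w + b *: w')).
Proof.
move=> /andP[/eqP l /eqP r] /andP[/eqP l' /eqP r'].
by rewrite !(linearD, linearZ) /= l r l' r' !eqxx.
Qed.

Definition swap_rel m n : linrel R (m + n) (n + m) :=
  LinRel (rel_fun := fun v w => (lsubmx v == rsubmx w) && (rsubmx v == lsubmx w))
    (@swap_rel_lin m n).

Fact copy_rel_lin n (a b : R) (x x' : 'rV[R]_n) (w w' : 'rV[R]_(n + n)) :
  (x == lsubmx w) && (lsubmx w == rsubmx w) ->
  (x' == lsubmx w') && (lsubmx w' == rsubmx w') ->
  (a *: x + b *: x' == lsubmx (a *: w + b *: w')) &&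
  (lsubmx (a *: w + b *: w') == rsubmx (a *: w + b *: w')).
Proof.
move=> /andP[/eqP -> /eqP e] /andP[/eqP -> /eqP e'].
by rewrite !(linearD, linearZ) /= e e' !eqxx.
Qed.

Definition copy_rel n : linrel R n (n + n) :=
  LinRel (rel_fun := fun x w => (x == lsubmx w) && (lsubmx w == rsubmx w))
    (@copy_rel_lin n).

Fact comp_rel_lin n (a b : R) (w w' : 'rV[R]_(n + n)) (z z' : 'rV[R]_n) :
  (lsubmx w == rsubmx w) && (rsubmx w == z) ->
  (lsubmx w' == rsubmx w') && (rsubmx w' == z') ->
  (lsubmx (a *: w + b *: w') == rsubmx (a *: w + b *: w')) &&
  (rsubmx (a *: w + b *: w') == a *: z + b *: z').
Proof.
move=> /andP[/eqP e /eqP <-] /andP[/eqP e' /eqP <-].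
by rewrite !(linearD, linearZ) /= e e' !eqxx.
Qed.

Definition comp_rel n : linrel R (n + n) n :=
  LinRel (rel_fun := fun w z => (lsubmx w == rsubmx w) && (rsubmx w == z))
    (@comp_rel_lin n).

Fact zero_rel_lin n (a b : R) (u u' : 'rV[R]_0) (x x' : 'rV[R]_n) :
  x == 0 -> x' == 0 -> a *: x + b *: x' == 0.
Proof. by move=> /eqP -> /eqP ->; rewrite !scaler0 addr0. Qed.

Definition zero_rel n : linrel R 0 n :=
  LinRel (rel_fun := fun _ x => x == 0) (@zero_rel_lin n).

Fact cozero_rel_lin n (a b : R) (x x' : 'rV[R]_n) (u u' : 'rV[R]_0) :
  x == 0 -> x' == 0 -> a *: x + b *: x' == 0.
Proof. by move=> /eqP -> /eqP ->; rewrite !scaler0 addr0. Qed.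

Definition cozero_rel n : linrel R n 0 :=
  LinRel (rel_fun := fun x _ => x == 0) (@cozero_rel_lin n).

Fact add_rel_lin n (a b : R) (w w' : 'rV[R]_(n + n)) (z z' : 'rV[R]_n) :
  lsubmx w + rsubmx w == z -> lsubmx w' + rsubmx w' == z' ->
  lsubmx (a *: w + b *: w') + rsubmx (a *: w + b *: w') == a *: z + b *: z'.
Proof.
move=> /eqP <- /eqP <-; rewrite !(linearD, linearZ) /=.
by rewrite addrACA.
Qed.

Definition add_rel n : linrel R (n + n) n :=
  LinRel (rel_fun := fun w z => lsubmx w + rsubmx w == z) (@add_rel_lin n).

Fact coadd_rel_lin n (a b : R) (z z' : 'rV[R]_n) (w w' : 'rV[R]_(n + n)) :
  lsubmx w + rsubmx w == z -> lsubmx w' + rsubmx w' == z' ->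
  lsubmx (a *: w + b *: w') + rsubmx (a *: w + b *: w') == a *: z + b *: z'.
Proof. exact: add_rel_lin. Qed.

Definition coadd_rel n : linrel R n (n + n) :=
  LinRel (rel_fun := fun z w => lsubmx w + rsubmx w == z) (@coadd_rel_lin n).

End Relations.

(* The monoidal structure is strict: associators and unitors are identities,
   transported along the equations (m + n) + p = m + (n + p), 0 + n = n and
   n + 0 = n between objects. *)
Definition cx_of_eq (R : realType) (m n : nat) (e : m = n) : cxbifn R m n :=
  ecast k (cxbifn R m k) e (cx_indic (eq_rel R m)).

Definition cv_of_eq (R : realType) (m n : nat) (e : m = n) : cvbifn R m n :=
  ecast k (cvbifn R m k) e (cv_indic (eq_rel R m)).

Definition CxBiFn (R : realType) : smc_data := {|
  obj := nat;
  hom := cxbifn R;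
  idm := fun n => cx_indic (eq_rel R n);
  compm := @cx_comp R;
  tens := addn;
  munit := 0%N;
  tensm := @cx_tens R;
  assoc := fun m n p => cx_of_eq R (esym (addnA m n p));
  unassoc := fun m n p => cx_of_eq R (addnA m n p);
  lunit := fun n => cx_of_eq R (add0n n);
  unlunit := fun n => cx_of_eq R (esym (add0n n));
  runit := fun n => cx_of_eq R (addn0 n);
  unrunit := fun n => cx_of_eq R (esym (addn0 n));
  braid := fun m n => cx_indic (swap_rel R m n) |}.

Definition CvBiFn (R : realType) : smc_data := {|
  obj := nat;
  hom := cvbifn R;
  idm := fun n => cv_indic (eq_rel R n);
  compm := @cv_comp R;
  tens := addn;
  munit := 0%N;
  tensm := @cv_tens R;
  assoc := fun m n p => cv_of_eq R (esym (addnA m n p));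
  unassoc := fun m n p => cv_of_eq R (addnA m n p);
  lunit := fun n => cv_of_eq R (add0n n);
  unlunit := fun n => cv_of_eq R (esym (add0n n));
  runit := fun n => cv_of_eq R (addn0 n);
  unrunit := fun n => cv_of_eq R (esym (addn0 n));
  braid := fun m n => cv_indic (swap_rel R m n) |}.

Definition cx_additive (R : realType) (n : obj (CxBiFn R)) :
    frobenius_data n :=
  @FrobeniusData (CxBiFn R) n
    (cx_indic (comp_rel R n)) (cx_zero R 0 n)
    (cx_indic (copy_rel R n)) (cx_zero R n 0).

Definition cx_coadditive (R : realType) (n : obj (CxBiFn R)) :
    frobenius_data n :=
  @FrobeniusData (CxBiFn R) n
    (cx_indic (add_rel R n)) (cx_indic (zero_rel R n))
    (cx_indic (coadd_rel R n)) (cx_indic (cozero_rel R n)).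

Definition cv_additive (R : realType) (n : obj (CvBiFn R)) :
    frobenius_data n :=
  @FrobeniusData (CvBiFn R) n
    (cv_indic (comp_rel R n)) (cv_zero R 0 n)
    (cv_indic (copy_rel R n)) (cv_zero R n 0).

Definition cv_coadditive (R : realType) (n : obj (CvBiFn R)) :
    frobenius_data n :=
  @FrobeniusData (CvBiFn R) n
    (cv_indic (add_rel R n)) (cv_indic (zero_rel R n))
    (cv_indic (coadd_rel R n)) (cv_indic (cozero_rel R n)).

Arguments cx_additive R n : clear implicits.
Arguments cx_coadditive R n : clear implicits.
Arguments cv_additive R n : clear implicits.
Arguments cv_coadditive R n : clear implicits.

(* Main.v *)
From mathcomp Require Import all_boot all_order all_algebra.
From mathcomp Require Import boolp classical_sets reals constructive_ereal ereal.
From mathcomp Require Import lra.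
Require Import Defs.
Set Implicit Arguments.
Unset Strict Implicit.
Unset Printing Implicit Defensive.
Import Order.TTheory GRing.Theory Num.Theory DualAddTheory.
Local Open Scope classical_set_scope.
Local Open Scope ring_scope.
Local Open Scope smc_scope.

(** Every structure map of the two Frobenius algebras, and every coherence map
of the monoidal category, is the indicator of a linear map read in one of the
two directions: with [graph f x y = {|f x = y|}] and [dagger F x y = F y x],
copying is the graph of [x |-> (x, x)], addition the graph of
[(x, y) |-> x + y], zero the graph of the map from R^0, discarding the graph of
the map to R^0, and the remaining four maps are their daggers. Composing with a
graph, or with the dagger of a graph, is substitution ([cx_comp_graphr],
[cx_comp_cographl]), since the infimum defining the composite is attained at the
only point where the indicator is finite. Composites and tensor products of
graphs are therefore graphs, and the coherence laws reduce to equations between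
functions on row vectors.

The laws that involve arbitrary bifunctions are the category axioms, the
functoriality of the tensor product and naturality. Associativity of composition
and the interchange law need infima to be exchanged with sums under the
convention (+oo) + (-oo) = +oo; with this convention F o G (x, z) < s holds
exactly when s = a + b with G (x, y) < a and F (y, z) < b for some y
([cx_comp_ltP]), and both laws become the regrouping of existential quantifiers.

Transposition is a contravariant identity-on-objects involution of CxBiFn that
preserves the symmetric monoidal structure, and in both Frobenius structures the
comonoid is the transpose of the monoid. Hence only the monoid laws, one
Frobenius law, speciality and compatibility of the monoid with the tensor product
have to be checked ([dagger_hypergraph]).

The concave statements follow from the convex ones because F |-> -F is an
isomorphism from CvBiFn to CxBiFn that preserves all the structure
([cv_hypergraph]). The two structures on R^n differ for n > 0 because their units
differ at every nonzero vector. *)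

(** * Composition and tensor product through strict upper bounds *)

Section StrictUpperBounds.
Variable R : realType.

Lemma eqe_ltP (x y : \bar R) :
  (forall s : R, (x < s%:E)%E <-> (y < s%:E)%E) -> x = y.
Proof.
have le (u v : \bar R) :
    (forall s : R, (v < s%:E)%E -> (u < s%:E)%E) -> (u <= v)%E.
  move=> uv; case: v uv => [v||] uv; last 1 first.
  - case: u uv => [u||] uv //.
      by have := uv u (ltNyr u); rewrite ltxx.
    by have := uv 0 (ltNyr 0).
  - by apply/lee_addgt0Pr => e e0; apply/ltW/uv; rewrite lte_fin ltrDl.
  - exact: leey.
by move=> xy; apply/eqP; rewrite eq_le !le // => s /xy.
Qed.

Lemma dadde_ltP (x y : \bar R) (s : R) : (x + y < s%:E)%dE <->
  exists a b : R, [/\ (x < a%:E)%E, (y < b%:E)%E & a + b = s].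
Proof.
split=> [|[a [b [xa yb <-]]]]; last first.
  case: x xa => [x||] //; case: y yb => [y||] //=; rewrite ?lte_fin => yb xa.
  - by rewrite ltrD.
  - exact: ltNyr.
  - exact: ltNyr.
  - exact: ltNyr.
case: x => [x||]; case: y => [y||] //.
- rewrite lte_fin => xys; exists (x + (s - (x + y)) / 2), (y + (s - (x + y)) / 2).
  by rewrite !lte_fin; split; lra.
- move=> _; exists (x + 1), (s - (x + 1)); rewrite lte_fin ltNyr; split=> //; lra.
- move=> _; exists (s - (y + 1)), (y + 1); rewrite lte_fin ltNyr; split=> //; lra.
- by move=> _; exists s, 0; rewrite !ltNyr addr0.
Qed.

(** No such equivalence holds for [<=], as the infimum need not be attained. *)
Lemma cx_comp_ltP m n p (F : bifn R n p) (G : bifn R m n) x z (s : R) :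
  (cx_comp_fun F G x z < s%:E)%E <->
  exists y (a b : R), [/\ (G x y < a%:E)%E, (F y z < b%:E)%E & a + b = s].
Proof.
split=> [/ereal_inf_lt [_ [y _ <-]] /dadde_ltP|[y /dadde_ltP lts]].
  by exists y.
by apply: le_lt_trans lts; apply: ereal_inf_lbound; exists y.
Qed.

Lemma cx_tens_ltP m n p q (F : bifn R m n) (G : bifn R p q) x y (s : R) :
  (cx_tens_fun F G x y < s%:E)%E <->
  exists a b : R, [/\ (F (lsubmx x) (lsubmx y) < a%:E)%E,
    (G (rsubmx x) (rsubmx y) < b%:E)%E & a + b = s].
Proof. exact: dadde_ltP. Qed.

Lemma cx_comp_funA m n p q (H : bifn R p q) (G : bifn R n p) (F : bifn R m n) :
  cx_comp_fun H (cx_comp_fun G F) = cx_comp_fun (cx_comp_fun H G) F.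
Proof.
apply/funext => x; apply/funext => w; apply: eqe_ltP => s; rewrite !cx_comp_ltP.
split=> [[z [r [c [/cx_comp_ltP [y [a [b [Fa Gb <-]]]] Hc <-]]]]|].
  exists y, a, (b + c); rewrite addrA; split=> //.
  by apply/cx_comp_ltP; exists z, b, c.
case=> y [a [r [Fa /cx_comp_ltP [z [b [c [Gb Hc <-]]]] <-]]].
exists z, (a + b), c; rewrite addrA; split=> //.
by apply/cx_comp_ltP; exists y, a, b.
Qed.

Lemma cx_tens_comp m n p m' n' p' (G : bifn R n p) (F : bifn R m n)
    (G' : bifn R n' p') (F' : bifn R m' n') :
  cx_tens_fun (cx_comp_fun G F) (cx_comp_fun G' F') =
  cx_comp_fun (cx_tens_fun G G') (cx_tens_fun F F').
Proof.
apply/funext => x; apply/funext => z; apply: eqe_ltP => s.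
rewrite cx_tens_ltP cx_comp_ltP; split.
  case=> r [r' [/cx_comp_ltP [y [a [b [Fa Gb <-]]]]]].
  move=> /cx_comp_ltP [y' [a' [b' [Fa' Gb' <-]]]] <-.
  exists (row_mx y y'), (a + a'), (b + b'); rewrite addrACA.
  by split=> //; apply/cx_tens_ltP; [exists a, a'|exists b, b'];
    rewrite !(row_mxKl, row_mxKr).
case=> y [r [r' [/cx_tens_ltP [a [a' [Fa Fa' <-]]]]]].
move=> /cx_tens_ltP [b [b' [Gb Gb' <-]]] <-.
exists (a + b), (a' + b'); rewrite addrACA.
by split=> //; apply/cx_comp_ltP; [exists (lsubmx y), a, b|exists (rsubmx y), a', b'].
Qed.

End StrictUpperBounds.

(** * Graphs of functions and transposition *)

Section Graphs.
Variable R : realType.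

(** The convex indicator of the graph of [f]; [f] is not required to be linear. *)
Definition graph m n (f : 'rV[R]_m -> 'rV[R]_n) : bifn R m n :=
  fun x y => indic R (f x == y).

(** The transposed bifunction. *)
Definition dagger m n (F : bifn R m n) : bifn R n m := fun x y => F y x.

(** The product of two functions, on concatenated row vectors. *)
Definition prodf m n p q (f : 'rV[R]_m -> 'rV[R]_n) (g : 'rV[R]_p -> 'rV[R]_q) :
    'rV[R]_(m + p) -> 'rV[R]_(n + q) :=
  fun x => row_mx (f (lsubmx x)) (g (rsubmx x)).

Lemma indic_dadde (b c : bool) : (indic R b + indic R c)%dE = indic R (b && c).
Proof. by case: b; case: c; rewrite /indic /= ?dadd0e. Qed.

Lemma cx_comp_graphr m n p (F : bifn R n p) (f : 'rV[R]_m -> 'rV[R]_n) :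
  cx_comp_fun F (graph f) = fun x => F (f x).
Proof.
apply/funext => x; apply/funext => z; apply/eqP; rewrite eq_le; apply/andP; split.
  by apply: ereal_inf_lbound; exists (f x) => //; rewrite /graph eqxx dadd0e.
apply: le_ereal_inf_tmp => _ [y _ <-]; rewrite /graph.
have [->|_] := eqVneq (f x) y; first by rewrite dadd0e.
by case: (F y z) => [r||]; exact: leey.
Qed.

Lemma dagger_comp m n p (F : bifn R n p) (G : bifn R m n) :
  dagger (cx_comp_fun F G) = cx_comp_fun (dagger G) (dagger F).
Proof.
apply/funext => z; apply/funext => x; rewrite /dagger /cx_comp_fun.
by congr ereal_inf; congr image; apply/funext => y; rewrite daddeC.
Qed.

Lemma daggerK m n : cancel (@dagger m n) (@dagger n m).
Proof. by []. Qed.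

Lemma cx_comp_cographl m n p (F : bifn R m n) (g : 'rV[R]_p -> 'rV[R]_n) :
  cx_comp_fun (dagger (graph g)) F = fun x z => F x (g z).
Proof. by rewrite -[LHS]daggerK dagger_comp cx_comp_graphr. Qed.

(** Here the two indicators meet at their common source, so the composite is the
indicator of an existential statement. *)
Lemma cx_comp_graph_cograph m n p (f : 'rV[R]_n -> 'rV[R]_p)
    (g : 'rV[R]_n -> 'rV[R]_m) x z :
  cx_comp_fun (graph f) (dagger (graph g)) x z =
  indic R `[< exists y, g y = x /\ f y = z >].
Proof.
apply: eqe_ltP => s; rewrite cx_comp_ltP /dagger /graph /indic.
case: asboolP => [[y [gy fy]]|nex].
  rewrite lte_fin; split=> [[y' [a [b [ya yb <-]]]]|s0].
    have [a0 b0] : 0 < a /\ 0 < b.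
      by move: ya yb; case: eqP => // _; case: eqP => // _; rewrite !lte_fin.
    exact: addr_gt0.
  by exists y, (s / 2), (s / 2); rewrite gy fy !eqxx !lte_fin -splitr divr_gt0.
split=> // -[y [a [b []]]]; case: eqP => // gy; case: eqP => // fy.
by case: nex; exists y.
Qed.

Lemma cx_tens_graph m n p q (f : 'rV[R]_m -> 'rV[R]_n) (g : 'rV[R]_p -> 'rV[R]_q) :
  cx_tens_fun (graph f) (graph g) = graph (prodf f g).
Proof.
apply/funext => x; apply/funext => y; rewrite /cx_tens_fun /graph indic_dadde.
congr indic; rewrite /prodf -[y in RHS]hsubmxK.
by apply/andP/eqP => [[/eqP -> /eqP ->]|/eq_row_mx [-> ->]].
Qed.

Lemma cx_tens_dagger m n p q (F : bifn R m n) (G : bifn R p q) :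
  cx_tens_fun (dagger F) (dagger G) = dagger (cx_tens_fun F G).
Proof. by []. Qed.

Lemma cx_ext m n (F G : cxbifn R m n) : cx_fun F = cx_fun G -> F = G.
Proof.
by case: F G => [F cF] [G cG] /= FG; subst G; rewrite (Prop_irrelevance cF cG).
Qed.

(** The identification of R^m with R^n along an equation [m = n]. *)
Definition castv m n (e : m = n) : 'rV[R]_m -> 'rV[R]_n := castmx (erefl, e).

Lemma cx_of_eqE m n (e : m = n) : cx_of_eq R e = graph (castv e) :> bifn R m n.
Proof. by case: n / e; apply/funext => x; rewrite /graph /castv castmx_id. Qed.

Lemma cx_idE n : cx_indic (eq_rel R n) = graph idfun :> bifn R n n.
Proof. by []. Qed.

(** The exchange of the two halves of a concatenated vector. *)
Definition swapv m n (x : 'rV[R]_(m + n)) : 'rV[R]_(n + m) :=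
  row_mx (rsubmx x) (lsubmx x).

Lemma cx_swapE m n : cx_indic (swap_rel R m n) = graph (@swapv m n) :> bifn R _ _.
Proof.
apply/funext => x; apply/funext => y; congr indic => /=.
rewrite /swapv -[y in RHS]hsubmxK.
by apply/andP/eqP => [[/eqP -> /eqP ->]|/eq_row_mx [-> ->]].
Qed.

Lemma castv_assoc m n p (a : 'rV[R]_m) (b : 'rV[R]_n) (c : 'rV[R]_p) :
  castv (esym (addnA m n p)) (row_mx (row_mx a b) c) = row_mx a (row_mx b c).
Proof. by rewrite row_mxA. Qed.

Lemma castv_unassoc m n p (a : 'rV[R]_m) (b : 'rV[R]_n) (c : 'rV[R]_p) :
  castv (addnA m n p) (row_mx a (row_mx b c)) = row_mx (row_mx a b) c.
Proof.
by rewrite -castv_assoc /castv castmx_comp castmx_id.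
Qed.

Lemma castv_add0 n (u : 'rV[R]_0) (x : 'rV[R]_n) : castv (add0n n) (row_mx u x) = x.
Proof. by rewrite row_thin_mx /castv castmx_id. Qed.

Lemma castv_addn0 n (u : 'rV[R]_0) (x : 'rV[R]_n) : castv (addn0 n) (row_mx x u) = x.
Proof.
apply/rowP => i; rewrite castmxE /= ord1 mxE.
by case: split_ordP => [j|[]//] /(congr1 val) /= ij; congr (x _ _); apply: val_inj.
Qed.

Lemma castvK m n (e : m = n) : cancel (castv e) (castv (esym e)).
Proof. by case: n / e => x; rewrite /castv !castmx_id. Qed.

Lemma castvKV m n (e : m = n) : cancel (castv (esym e)) (castv e).
Proof. by case: n / e => x; rewrite /castv !castmx_id. Qed.

Lemma row_mxP m n (P : 'rV[R]_(m + n) -> Prop) :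
  (forall a b, P (row_mx a b)) -> forall x, P x.
Proof. by move=> PP x; rewrite -[x]hsubmxK. Qed.

Lemma prodf_row m n p q (f : 'rV[R]_m -> 'rV[R]_n) (g : 'rV[R]_p -> 'rV[R]_q) x y :
  prodf f g (row_mx x y) = row_mx (f x) (g y).
Proof. by rewrite /prodf row_mxKl row_mxKr. Qed.

Lemma swapv_row m n (x : 'rV[R]_m) (y : 'rV[R]_n) :
  swapv (row_mx x y) = row_mx y x.
Proof. by rewrite /swapv row_mxKl row_mxKr. Qed.

(** A special case of [cx_comp_graphr], stated so that the composite is again
syntactically a graph. *)
Lemma cx_comp_graph m n p (f : 'rV[R]_n -> 'rV[R]_p) (g : 'rV[R]_m -> 'rV[R]_n) :
  cx_comp_fun (graph f) (graph g) = graph (f \o g).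
Proof. exact: cx_comp_graphr. Qed.

Lemma dagger_graph_can m n (f : 'rV[R]_m -> 'rV[R]_n) g : cancel f g -> cancel g f ->
  dagger (graph f) = graph g.
Proof.
move=> fK gK; apply/funext => y; apply/funext => x; congr indic.
by apply/eqP/eqP => <-.
Qed.

Lemma cx_comp_graphl m n p (F : bifn R m n) (f : 'rV[R]_n -> 'rV[R]_p) g :
  cancel f g -> cancel g f -> cx_comp_fun (graph f) F = fun x z => F x (g z).
Proof. by move=> fK gK; rewrite -(dagger_graph_can gK fK) cx_comp_cographl. Qed.

Lemma swapvK m n : cancel (@swapv m n) (@swapv n m).
Proof. by apply: row_mxP => a b; rewrite !swapv_row. Qed.

Lemma cx_compE m n p (F : cxbifn R n p) (G : cxbifn R m n) :
  cx_fun (cx_comp F G) = cx_comp_fun F G.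
Proof. by []. Qed.

Lemma cx_tensE m n p q (F : cxbifn R m n) (G : cxbifn R p q) :
  cx_fun (cx_tens F G) = cx_tens_fun F G.
Proof. by []. Qed.

(** Turns an expression built from the structure maps of CxBiFn into the graph of
a single function. *)
Definition cx_structE :=
  (cx_compE, cx_tensE, cx_of_eqE, cx_idE, cx_swapE, cx_tens_graph, cx_comp_graph).

(** * The symmetric monoidal structure of CxBiFn *)

Lemma cx_symmetric_monoidal : symmetric_monoidal (CxBiFn R).
Proof.
split=> /=.
- move=> a b f; apply: cx_ext; rewrite cx_compE cx_idE.
  by rewrite (cx_comp_graphl _ (g := idfun)).
- by move=> a b f; apply: cx_ext; rewrite cx_compE cx_idE cx_comp_graphr.
- by move=> a b c d h g f; apply: cx_ext; exact: cx_comp_funA.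
- move=> a b; apply: cx_ext; rewrite !cx_structE; congr graph; apply/funext.
  by apply: row_mxP => x y; rewrite prodf_row.
- by move=> *; apply: cx_ext; exact: cx_tens_comp.
- move=> a b c; apply: cx_ext; rewrite !cx_structE; congr graph; apply/funext => x /=.
  exact: castvKV.
- move=> a b c; apply: cx_ext; rewrite !cx_structE; congr graph; apply/funext => x /=.
  exact: castvK.
- move=> a; apply: cx_ext; rewrite !cx_structE; congr graph; apply/funext => x /=.
  exact: castvK.
- move=> a; apply: cx_ext; rewrite !cx_structE; congr graph; apply/funext => x /=.
  exact: castvKV.
- move=> a; apply: cx_ext; rewrite !cx_structE; congr graph; apply/funext => x /=.
  exact: castvK.
- move=> a; apply: cx_ext; rewrite !cx_structE; congr graph; apply/funext => x /=.
  exact: castvKV.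
- move=> a b c a' b' c' f g h; apply: cx_ext;
  rewrite !(cx_compE, cx_tensE) !cx_of_eqE cx_comp_graphr.
  rewrite (cx_comp_graphl _ (castvKV _) (castvK _)).
  apply/funext; apply: row_mxP; apply: row_mxP => x1 x2 x3.
  apply/funext; apply: row_mxP => y1; apply: row_mxP => y2 y3.
  by rewrite castv_assoc castv_unassoc /cx_tens_fun !(row_mxKl, row_mxKr) daddeA.
- move=> a b f; apply: cx_ext;
  rewrite !(cx_compE, cx_tensE) !cx_of_eqE cx_comp_graphr.
  rewrite (cx_comp_graphl _ (castvK _) (castvKV _)).
  apply/funext; apply: row_mxP => u x; apply/funext => y.
  rewrite castv_add0 -[in RHS](castvKV (add0n b) y).
  move: (castv _ y); apply: row_mxP => v {}y.
  rewrite castv_add0 /cx_tens_fun !(row_mxKl, row_mxKr).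
  by rewrite [u]thinmx0 [v]thinmx0 /= /indic eqxx dadd0e.
- move=> a b f; apply: cx_ext;
  rewrite !(cx_compE, cx_tensE) !cx_of_eqE cx_comp_graphr.
  rewrite (cx_comp_graphl _ (castvK _) (castvKV _)).
  apply/funext; apply: row_mxP => x u; apply/funext => y.
  rewrite castv_addn0 -[in RHS](castvKV (addn0 b) y).
  move: (castv _ y); apply: row_mxP => {}y v.
  rewrite castv_addn0 /cx_tens_fun !(row_mxKl, row_mxKr).
  by rewrite [u]thinmx0 [v]thinmx0 /= /indic eqxx dadde0.
- move=> a b a' b' f g; apply: cx_ext;
  rewrite !(cx_compE, cx_tensE) !cx_swapE cx_comp_graphr.
  rewrite (cx_comp_graphl _ (@swapvK _ _) (@swapvK _ _)).
  apply/funext; apply: row_mxP => x1 x2; apply/funext; apply: row_mxP => y1 y2.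
  by rewrite !swapv_row /cx_tens_fun !(row_mxKl, row_mxKr) daddeC.
- move=> a b c d; apply: cx_ext; rewrite !cx_structE; congr graph; apply/funext.
  apply: row_mxP; apply: row_mxP; apply: row_mxP => x y z w.
  by rewrite /= !(castv_assoc, prodf_row).
- move=> a b; apply: cx_ext; rewrite !cx_structE; congr graph; apply/funext.
  apply: row_mxP; apply: row_mxP => x u y.
  by rewrite /= !(castv_assoc, prodf_row) castv_add0 castv_addn0.
- move=> a b c; apply: cx_ext; rewrite !cx_structE; congr graph; apply/funext.
  apply: row_mxP; apply: row_mxP => x y z.
  by rewrite /= !(castv_assoc, prodf_row, swapv_row).
- move=> a b; apply: cx_ext; rewrite !cx_structE; congr graph; apply/funext => x /=.
  exact: swapvK.
Qed.
End Graphs.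

(** * Hypergraph structures in dagger categories *)

(** [dag] is a contravariant involution, the identity on objects, that preserves
the tensor product and sends each structural isomorphism to its inverse. *)
Record dagger_monoidal (C : smc_data)
    (dag : forall a b : obj C, hom a b -> hom b a) : Prop := DaggerMonoidal {
  dagK : forall (a b : obj C) (f : hom a b), dag _ _ (dag _ _ f) = f;
  dag1 : forall a : obj C, dag _ _ (idm a) = idm a;
  dagM : forall (a b c : obj C) (g : hom b c) (f : hom a b),
    dag _ _ (g ∘ f) = dag _ _ f ∘ dag _ _ g;
  dag_tens : forall (a b c d : obj C) (f : hom a b) (g : hom c d),
    dag _ _ (f ⊗ g) = dag _ _ f ⊗ dag _ _ g;
  dag_assoc : forall a b c : obj C, dag _ _ (assoc a b c) = unassoc a b c;
  dag_lunit : forall a : obj C, dag _ _ (lunit a) = unlunit a;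
  dag_runit : forall a : obj C, dag _ _ (runit a) = unrunit a;
  dag_braid : forall a b : obj C, dag _ _ (braid a b) = braid b a }.

(** If the comonoid is the dagger of the monoid, the comonoid laws and the second
Frobenius law are the daggers of the monoid laws and of the first Frobenius law. *)
Lemma dagger_hypergraph (C : smc_data)
    (dag : forall a b : obj C, hom a b -> hom b a)
    (S : forall a : obj C, frobenius_data a) :
  symmetric_monoidal C -> dagger_monoidal dag ->
  (forall a, fcomul (S a) = dag _ _ (fmul (S a))) ->
  (forall a, fcounit (S a) = dag _ _ (funit (S a))) ->
  (forall a, fmul (S a) ∘ (fmul (S a) ⊗ idm a) =
    fmul (S a) ∘ (idm a ⊗ fmul (S a)) ∘ assoc a a a) ->
  (forall a, fmul (S a) ∘ (funit (S a) ⊗ idm a) = lunit a) ->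
  (forall a, fmul (S a) ∘ (idm a ⊗ funit (S a)) = runit a) ->
  (forall a, fmul (S a) ∘ braid a a = fmul (S a)) ->
  (forall a, (idm a ⊗ fmul (S a)) ∘ assoc a a a ∘ (fcomul (S a) ⊗ idm a) =
    fcomul (S a) ∘ fmul (S a)) ->
  (forall a, fmul (S a) ∘ fcomul (S a) = idm a) ->
  (forall a b, fmul (S (tens a b)) =
    (fmul (S a) ⊗ fmul (S b)) ∘ middle_swap a b a b) ->
  (forall a b, funit (S (tens a b)) =
    (funit (S a) ⊗ funit (S b)) ∘ unlunit (munit C)) ->
  fmul (S (munit C)) = lunit (munit C) ->
  funit (S (munit C)) = idm (munit C) ->
  hypergraph_category C S.
Proof.
move=> smc dg comulE counitE mulA mul1l mul1r mulC frob spec mulT unitT mulI unitI.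
have dag_unassoc a b c : dag _ _ (unassoc a b c) = assoc a b c.
  by rewrite -(dag_assoc dg) (dagK dg).
have dag_unlunit a : dag _ _ (unlunit a) = lunit a.
  by rewrite -(dag_lunit dg) (dagK dg).
have dagE := (dagM dg, dag_tens dg, dag1 dg, dag_assoc dg, dag_unassoc,
  dag_lunit dg, dag_unlunit, dag_runit dg, dag_braid dg).
split=> // [a|a b|a b||]; rewrite ?comulE ?counitE.
- split=> //; rewrite ?comulE ?counitE.
  + have := congr1 (dag _ _) (mulA a); rewrite !dagE => mulAd.
    by rewrite -(compmA smc) mulAd !(compmA smc) (unassocK smc) (comp1m smc).
  + by rewrite -(dag_lunit dg) -mul1l !dagE.
  + by rewrite -(dag_runit dg) -mul1r !dagE.
  + by rewrite -(dag_braid dg) -(dagM dg) mulC.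
  + have := congr1 (dag _ _) (frob a).
    by rewrite !dagE !comulE !(dagK dg) !(compmA smc).
- by rewrite mulT /middle_swap !dagE !(compmA smc).
- by rewrite unitT !dagE.
- by rewrite mulI !dagE.
- by rewrite unitI !dagE.
Qed.

(** * The additive and co-additive structures on CxBiFn *)

Section ConvexHypergraph.
Variable R : realType.

Lemma dagger_convex m n (F : cxbifn R m n) : cvx (uncurry_bifn (dagger F)).
Proof.
have /cvxP cF := cx_convex F; apply/cvxP => t [y x] [y' x'] a b /= Fa Fb.
exact: (cF t (x, y) (x', y')).
Qed.

(** Transposition, as an operation on convex bifunctions. *)
Definition cx_dagger m n (F : cxbifn R m n) : cxbifn R n m :=
  CxBifn (@dagger_convex m n F).

Lemma cx_dagger_of_eq m n (e : m = n) : cx_dagger (cx_of_eq R e) = cx_of_eq R (esym e).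
Proof.
apply: cx_ext; rewrite cx_of_eqE -(dagger_graph_can (@castvK R _ _ e) (@castvKV R _ _ e)).
by rewrite -(@cx_of_eqE R _ _ e).
Qed.

Lemma cx_dagger_monoidal : @dagger_monoidal (CxBiFn R) cx_dagger.
Proof.
split=> //=; last 1 first.
- move=> m n; apply: cx_ext; rewrite (cx_swapE R n m).
  rewrite -(dagger_graph_can (@swapvK R m n) (@swapvK R n m)).
  by rewrite -(cx_swapE R m n).
- by move=> *; apply: cx_ext.
- move=> n; apply: cx_ext; rewrite cx_idE.
  by rewrite -[RHS](dagger_graph_can (f := idfun)).
- by move=> *; apply: cx_ext; exact: dagger_comp.
- by move=> *; apply: cx_ext.
- by move=> m n p; rewrite cx_dagger_of_eq esymK.
- by move=> n; rewrite cx_dagger_of_eq.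
- by move=> n; rewrite cx_dagger_of_eq.
Qed.

(** The maps behind the two structures: the diagonal, the addition, the zero
vector, and the map to the point. *)
Definition diagv n (x : 'rV[R]_n) : 'rV[R]_(n + n) := row_mx x x.
Definition addv n (w : 'rV[R]_(n + n)) : 'rV[R]_n := lsubmx w + rsubmx w.
Definition zerov n (u : 'rV[R]_0) : 'rV[R]_n := 0.
Definition termv n (x : 'rV[R]_n) : 'rV[R]_0 := 0.

Lemma cx_copyE n : cx_indic (copy_rel R n) = graph (@diagv n) :> bifn R _ _.
Proof.
apply/funext => x; apply/funext; apply: row_mxP => a b; congr indic => /=.
rewrite row_mxKl row_mxKr; apply/andP/eqP => [[/eqP -> /eqP ->]//|].
by case/eq_row_mx => <- <-.
Qed.

Lemma cx_mergeE n : cx_indic (comp_rel R n) = dagger (graph (@diagv n)) :> bifn R _ _.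
Proof.
apply/funext; apply: row_mxP => a b; apply/funext => x; congr indic => /=.
rewrite row_mxKl row_mxKr; apply/andP/eqP => [[/eqP -> /eqP ->]//|].
by case/eq_row_mx => <- <-.
Qed.

Lemma cx_addE n : cx_indic (add_rel R n) = graph (@addv n) :> bifn R _ _.
Proof. by []. Qed.

Lemma cx_zerorelE n : cx_indic (zero_rel R n) = graph (@zerov n) :> bifn R _ _.
Proof. by apply/funext => x; apply/funext => y; rewrite /graph eq_sym. Qed.

(** A function into R^0 identifies all points, so its graph is constantly 0. *)
Lemma cx_constE n : cx_zero R 0 n = dagger (graph (@termv n)) :> bifn R _ _.
Proof.
by apply/funext => u; apply/funext => y; rewrite /dagger /graph /indic [u]thinmx0 eqxx.
Qed.

Lemma addv_row n (x y : 'rV[R]_n) : addv (row_mx x y) = x + y.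
Proof. by rewrite /addv row_mxKl row_mxKr. Qed.

(** The exchange ((x, y), (z, w)) |-> ((x, z), (y, w)). *)
Definition middle_swapv m n p q (w : 'rV[R]_((m + n) + (p + q))) :
    'rV[R]_((m + p) + (n + q)) :=
  row_mx (row_mx (lsubmx (lsubmx w)) (lsubmx (rsubmx w)))
         (row_mx (rsubmx (lsubmx w)) (rsubmx (rsubmx w))).

Lemma middle_swapv_row m n p q (x : 'rV[R]_m) (y : 'rV[R]_n) (z : 'rV[R]_p)
    (w : 'rV[R]_q) :
  middle_swapv (row_mx (row_mx x y) (row_mx z w)) =
  row_mx (row_mx x z) (row_mx y w).
Proof. by rewrite /middle_swapv !(row_mxKl, row_mxKr). Qed.

Lemma cx_middle_swapE (m n p q : nat) :
  cx_fun (@middle_swap (CxBiFn R) m n p q) = graph (@middle_swapv m n p q).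
Proof.
rewrite /middle_swap; cbn [compm tensm assoc unassoc braid idm CxBiFn].
rewrite !cx_structE; congr graph; apply/funext.
apply: row_mxP; apply: row_mxP => x y; apply: row_mxP => z w.
rewrite /= castv_assoc prodf_row middle_swapv_row /=.
by rewrite castv_unassoc prodf_row swapv_row castv_assoc castv_unassoc.
Qed.

Lemma eq_row_mxE m n (a c : 'rV[R]_m) (b d : 'rV[R]_n) :
  (row_mx a b == row_mx c d) = (a == c) && (b == d).
Proof.
by apply/eqP/andP => [/eq_row_mx [-> ->]|[/eqP -> /eqP ->]].
Qed.

Lemma indic_asbool (b : bool) (P : Prop) : (b <-> P) -> indic R b = indic R `[<P>].
Proof. by move=> bP; congr indic; apply/idP/asboolP => /bP. Qed.

Lemma cx_coadditive_hypergraph : hypergraph_category (CxBiFn R) (cx_coadditive R).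
Proof.
have addE := (cx_compE, cx_tensE, cx_addE, cx_zerorelE, cx_of_eqE, cx_idE, cx_swapE,
  cx_tens_graph, cx_comp_graph).
have coaddE n : cx_indic (coadd_rel R n) = dagger (graph (@addv n)) :> bifn R _ _ by [].
apply: (dagger_hypergraph (@cx_symmetric_monoidal R) cx_dagger_monoidal) => /=.
- by move=> n; apply: cx_ext.
- by move=> n; apply: cx_ext.
- move=> n; apply: cx_ext; rewrite !addE; congr graph; apply/funext.
  apply: row_mxP; apply: row_mxP => x y z /=.
  by rewrite castv_assoc !(prodf_row, addv_row) addrA.
- move=> n; apply: cx_ext; rewrite !addE; congr graph; apply/funext.
  by apply: row_mxP => u x /=; rewrite castv_add0 prodf_row addv_row add0r.
- move=> n; apply: cx_ext; rewrite !addE; congr graph; apply/funext.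
  by apply: row_mxP => x u /=; rewrite castv_addn0 prodf_row addv_row addr0.
- move=> n; apply: cx_ext; rewrite !addE; congr graph; apply/funext.
  by apply: row_mxP => x y /=; rewrite swapv_row !addv_row addrC.
- move=> n; apply: cx_ext; rewrite !(cx_compE, cx_tensE) coaddE.
  (* the identity next to the co-addition is written as the dagger of a graph,
     so that the tensor product becomes the dagger of a single graph *)
  rewrite cx_idE -(dagger_graph_can (f := @idfun 'rV[R]_n) (g := idfun)) //.
  rewrite cx_tens_dagger (dagger_graph_can (f := @idfun 'rV[R]_n) (g := idfun)) //.
  rewrite !addE cx_comp_cographl.
  apply/funext; apply: row_mxP => x y; apply/funext; apply: row_mxP => z w.
  rewrite cx_comp_graph_cograph /graph; apply/esym/indic_asbool.
  rewrite !addv_row; split.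
    (* split x as z + (x - z) and pass the second summand on to y *)
    move=> /eqP xyzw; exists (row_mx (row_mx z (x - z)) y).
    rewrite /= castv_assoc !prodf_row !addv_row /=; split; congr row_mx.
      by rewrite addrC subrK.
    by rewrite addrAC xyzw addrC addKr.
  case=> v []; elim/row_mxP: v => v y'; elim/row_mxP: v => a b.
  rewrite /= castv_assoc !prodf_row !addv_row /=.
  by move=> /eq_row_mx [<- <-] /eq_row_mx [<- <-]; rewrite addrA.
- move=> n; apply: cx_ext; rewrite cx_compE cx_addE coaddE cx_idE.
  apply/funext => x; apply/funext => y; rewrite cx_comp_graph_cograph.
  apply/esym/indic_asbool; split=> [/eqP <-|[w [<- <-]]//].
  by exists (row_mx x 0); rewrite addv_row addr0.
- move=> m n; apply: cx_ext; rewrite cx_compE cx_middle_swapE !addE; congr graph.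
  apply/funext; apply: row_mxP; apply: row_mxP => x y; apply: row_mxP => z w /=.
  by rewrite middle_swapv_row prodf_row !addv_row add_row_mx.
- move=> m n; apply: cx_ext; rewrite !addE; congr graph; apply/funext => u /=.
  by rewrite /prodf /zerov row_mx0.
- apply: cx_ext; rewrite !addE; congr graph; apply/funext => u.
  by rewrite [LHS]thinmx0 [RHS]thinmx0.
- apply: cx_ext; rewrite !addE; congr graph; apply/funext => u.
  by rewrite [LHS]thinmx0 [RHS]thinmx0.
Qed.

Lemma cx_additive_hypergraph : hypergraph_category (CxBiFn R) (cx_additive R).
Proof.
(* All maps of the monoid laws are written as daggers of graphs, isomorphisms
   being the daggers of the graphs of their inverses. *)
have id_dag n : graph (@idfun 'rV[R]_n) = dagger (graph idfun).
  by rewrite -[LHS](dagger_graph_can (f := idfun)).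
have castE m n (e : m = n) : graph (@castv R m n e) = dagger (graph (castv (esym e))).
  by rewrite -[LHS](dagger_graph_can (@castvKV R _ _ e) (@castvK R _ _ e)).
have swapE m n : graph (@swapv R m n) = dagger (graph (@swapv R n m)).
  by rewrite (dagger_graph_can (@swapvK R n m) (@swapvK R m n)).
have mid_can m n p q : cancel (@middle_swapv m n p q) (@middle_swapv m p n q).
  apply: row_mxP; apply: row_mxP => x y; apply: row_mxP => z w.
  by rewrite !middle_swapv_row.
have midE m n p q : graph (@middle_swapv m n p q) = dagger (graph (@middle_swapv m p n q)).
  by rewrite (dagger_graph_can (mid_can _ _ _ _) (mid_can _ _ _ _)).
have comE := (cx_compE, cx_tensE, cx_mergeE, cx_constE, cx_of_eqE, cx_idE, cx_swapE).
have dagE := (cx_tens_dagger, cx_tens_graph, =^~ dagger_comp, cx_comp_graph).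
apply: (dagger_hypergraph (@cx_symmetric_monoidal R) cx_dagger_monoidal) => /=.
- move=> n; apply: cx_ext; rewrite cx_copyE; apply: esym.
  by rewrite -[LHS]/(dagger (cx_indic (comp_rel R n))) cx_mergeE.
- by move=> n; apply: cx_ext.
- move=> n; apply: cx_ext; rewrite !comE id_dag castE !dagE.
  congr dagger; congr graph; apply/funext => x /=.
  by rewrite /diagv !prodf_row esymK castv_unassoc.
- move=> n; apply: cx_ext; rewrite !comE id_dag castE !dagE.
  congr dagger; congr graph; apply/funext => x /=.
  rewrite /diagv !prodf_row -[x in RHS](castv_add0 (termv x)).
  by rewrite castvK.
- move=> n; apply: cx_ext; rewrite !comE id_dag castE !dagE.
  congr dagger; congr graph; apply/funext => x /=.
  rewrite /diagv !prodf_row -[x in RHS](castv_addn0 (termv x)).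
  by rewrite castvK.
- move=> n; apply: cx_ext; rewrite !comE swapE !dagE.
  by congr dagger; congr graph; apply/funext => x /=; rewrite swapv_row.
- move=> n; apply: cx_ext.
  rewrite !(cx_compE, cx_tensE) cx_mergeE cx_copyE cx_of_eqE cx_idE.
  (* only the identity next to the multiplication has to be a dagger *)
  rewrite [X in cx_tens_fun X (dagger _)]id_dag cx_tens_dagger !cx_tens_graph.
  rewrite -cx_comp_funA cx_comp_graph cx_comp_cographl.
  apply/funext; apply: row_mxP => x y; apply/funext; apply: row_mxP => z w.
  rewrite cx_comp_graph_cograph; apply: indic_asbool.
  rewrite /= !prodf_row castv_assoc /= !eq_row_mxE; split.
    by move=> /and3P [/eqP <- /eqP <- /eqP ->]; exists x.
  by case=> v [/eq_row_mx [<- <-] /eq_row_mx [<- <-]]; rewrite !eqxx.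
- move=> n; apply: cx_ext; rewrite cx_compE cx_mergeE cx_copyE cx_idE.
  rewrite cx_comp_cographl; apply/funext => x; apply/funext => y.
  by rewrite /graph eq_row_mxE andbb.
- move=> m n; apply: cx_ext; rewrite cx_compE cx_middle_swapE !comE midE !dagE.
  congr dagger; congr graph; apply/funext; apply: row_mxP => x y.
  by rewrite /= prodf_row middle_swapv_row.
- move=> m n; apply: cx_ext; rewrite !comE castE !dagE.
  congr dagger; congr graph; apply/funext => x.
  by rewrite [LHS]thinmx0 [RHS]thinmx0.
- apply: cx_ext; rewrite !comE castE; congr dagger; congr graph; apply/funext => u.
  by rewrite [LHS]thinmx0 [RHS]thinmx0.
- apply: cx_ext; rewrite !comE id_dag; congr dagger; congr graph; apply/funext => u.
  by rewrite [LHS]thinmx0 [RHS]thinmx0.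
Qed.

(** At a nonzero vector the unit of the additive structure is 0 and that of the
co-additive structure is [+oo]. *)
Lemma cx_additive_neq_coadditive n : (0 < n)%N -> cx_additive R n <> cx_coadditive R n.
Proof.
case: n => // n _ /(congr1 (fun S => cx_fun (@funit (CxBiFn R) n.+1 S) 0 (const_mx 1))) /=.
by rewrite /indic; case: eqP => // /rowP /(_ ord0); rewrite !mxE => /eqP; rewrite oner_eq0.
Qed.

End ConvexHypergraph.

(** * Concave bifunctions, by negation *)

Section Concave.
Variable R : realType.

Lemma cv_opp_inj m n : injective (@cv_opp R m n).
Proof.
move=> [F cF] [G cG] /(congr1 (@cx_fun R m n)) /= FG.
have {FG} FG : F = G.
  apply/funext => x; apply/funext => y; apply: oppe_inj.
  exact: (congr1 (fun H => H x y) FG).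
by subst G; rewrite (Prop_irrelevance cF cG).
Qed.

Lemma cv_opp_comp m n p (F : cvbifn R n p) (G : cvbifn R m n) :
  cv_opp (cv_comp F G) = cx_comp (cv_opp F) (cv_opp G).
Proof.
apply: cx_ext; apply/funext => x; apply/funext => z /=.
rewrite /cx_comp_fun /cv_comp_fun -ereal_infN; congr ereal_inf.
rewrite image_comp; congr image; apply/funext => y /=.
by rewrite dual_addeE !oppeK.
Qed.

Lemma cv_opp_tens m n p q (F : cvbifn R m n) (G : cvbifn R p q) :
  cv_opp (cv_tens F G) = cx_tens (cv_opp F) (cv_opp G).
Proof.
apply: cx_ext; apply/funext => x; apply/funext => y /=.
by rewrite /cx_tens_fun /cv_tens_fun dual_addeE !oppeK.
Qed.

Lemma cv_opp_indic m n (P : linrel R m n) : cv_opp (cv_indic P) = cx_indic P.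
Proof.
by apply: cx_ext; apply/funext => x; apply/funext => y /=; rewrite oppeK.
Qed.

Lemma cv_opp_zero m n : cv_opp (cv_zero R m n) = cx_zero R m n.
Proof.
by apply: cx_ext; apply/funext => x; apply/funext => y; exact: oppe0.
Qed.

Lemma cv_opp_of_eq m n (e : m = n) : cv_opp (cv_of_eq R e) = cx_of_eq R e.
Proof. by case: n / e; exact: cv_opp_indic. Qed.

Definition cv_oppE :=
  (cv_opp_comp, cv_opp_tens, cv_opp_indic, cv_opp_zero, cv_opp_of_eq).

Lemma cv_opp_middle_swap (m n p q : nat) :
  cv_opp (@middle_swap (CvBiFn R) m n p q) = @middle_swap (CxBiFn R) m n p q.
Proof. by rewrite /middle_swap /= !cv_oppE. Qed.

Lemma cv_symmetric_monoidal : symmetric_monoidal (CvBiFn R).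
Proof.
have smc := cx_symmetric_monoidal R.
split=> /= *; apply: cv_opp_inj; rewrite !cv_oppE.
- exact: (comp1m smc).
- exact: (compm1 smc).
- exact: (compmA smc).
- exact: (tensm1 smc).
- exact: (tensmM smc).
- exact: (assocK smc).
- exact: (unassocK smc).
- exact: (lunitK smc).
- exact: (unlunitK smc).
- exact: (runitK smc).
- exact: (unrunitK smc).
- exact: (assoc_natural smc).
- exact: (lunit_natural smc).
- exact: (runit_natural smc).
- exact: (braid_natural smc).
- exact: (pentagon smc).
- exact: (triangle smc).
- exact: (hexagon smc).
- exact: (braidK smc).
Qed.

(** A family of Frobenius structures on CvBiFn whose negation makes CxBiFn a
hypergraph category makes CvBiFn one. *)
Lemma cv_hypergraph (S : forall n, @frobenius_data (CxBiFn R) n)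
    (T : forall n, @frobenius_data (CvBiFn R) n) :
  (forall n, cv_opp (fmul (T n)) = fmul (S n)) ->
  (forall n, cv_opp (funit (T n)) = funit (S n)) ->
  (forall n, cv_opp (fcomul (T n)) = fcomul (S n)) ->
  (forall n, cv_opp (fcounit (T n)) = fcounit (S n)) ->
  hypergraph_category (CxBiFn R) S -> hypergraph_category (CvBiFn R) T.
Proof.
move=> mulE unitE comulE counitE hyp.
have frob := hypergraph_frobenius hyp.
have TE := (cv_oppE, cv_opp_middle_swap, mulE, unitE, comulE, counitE).
split=> [|n|m n|m n|m n|m n||||]; first exact: cv_symmetric_monoidal;
  first split; apply: cv_opp_inj; rewrite /= !TE.
- exact: (fmulA (frob n)).
- exact: (fmul1l (frob n)).
- exact: (fmul1r (frob n)).
- exact: (fmulC (frob n)).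
- exact: (fcomulA (frob n)).
- exact: (fcomul1l (frob n)).
- exact: (fcomul1r (frob n)).
- exact: (fcomulC (frob n)).
- exact: (frobeniusl (frob n)).
- exact: (frobeniusr (frob n)).
- exact: (fspecial (frob n)).
- exact: (fmul_tens hyp).
- exact: (funit_tens hyp).
- exact: (fcomul_tens hyp).
- exact: (fcounit_tens hyp).
- exact: etrans (mulE 0%N) (fmul_munit hyp).
- exact: (funit_munit hyp).
- exact: (fcomul_munit hyp).
- exact: (fcounit_munit hyp).
Qed.

Lemma cv_additive_hypergraph : hypergraph_category (CvBiFn R) (cv_additive R).
Proof.
apply: cv_hypergraph (cx_additive_hypergraph R) => n /=;
  by rewrite ?cv_opp_indic ?cv_opp_zero.
Qed.

Lemma cv_coadditive_hypergraph : hypergraph_category (CvBiFn R) (cv_coadditive R).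
Proof.
by apply: cv_hypergraph (cx_coadditive_hypergraph R) => n /=; rewrite cv_opp_indic.
Qed.

Lemma cv_additive_neq_coadditive n : (0 < n)%N -> cv_additive R n <> cv_coadditive R n.
Proof.
case: n => // n _ /(congr1 (fun S => cv_fun (@funit (CvBiFn R) n.+1 S) 0 (const_mx 1))) /=.
by rewrite /indic; case: eqP => // /rowP /(_ ord0); rewrite !mxE => /eqP; rewrite oner_eq0.
Qed.

End Concave.

Local Close Scope ring_scope.

Theorem proposition5 (R : realType) :
  [/\ hypergraph_category (CxBiFn R) (cx_additive R),
      hypergraph_category (CxBiFn R) (cx_coadditive R) &
      forall n : nat, 0 < n -> cx_additive R n <> cx_coadditive R n] /\
  [/\ hypergraph_category (CvBiFn R) (cv_additive R),
      hypergraph_category (CvBiFn R) (cv_coadditive R) &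
      forall n : nat, 0 < n -> cv_additive R n <> cv_coadditive R n].
Proof.
split; split.
- exact: cx_additive_hypergraph.
- exact: cx_coadditive_hypergraph.
- exact: cx_additive_neq_coadditive.
- exact: cv_additive_hypergraph.
- exact: cv_coadditive_hypergraph.
- exact: cv_additive_neq_coadditive.
Qed.
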